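(* (Cross-layer sub-gradient KKT.) For each of the $LH$ (layer, head) pairs $(\ell,h)$, let $B\mapsto D^\star_{\ell,h}(B)\ge0$ be the optimal head-level distortion as a function of the integer bit budget $B\ge B_{\min}$. Assume that for every $(\ell,h)$ this sequence is non-increasing and discrete-convex: $D^\star_{\ell,h}(B+1)-2D^\star_{\ell,h}(B)+D^\star_{\ell,h}(B-1)\ge0$ for every interior integer $B$. Let $\widetilde D^\star_{\ell,h}:\mathbb{R}_{\ge B_{\min}}\to\mathbb{R}_{\ge0}$ be the piecewise-linear envelope of $D^\star_{\ell,h}$ (linear interpolation between consecutive integer grid points). Then $\widetilde D^\star_{\ell,h}$ is convex, non-increasing, and continuous, with sub-differential $$\partial\widetilde D^\star_{\ell,h}(B)=\bigl[D^\star_{\ell,h}(B)-D^\star_{\ell,h}(B-1),\;D^\star_{\ell,h}(B+1)-D^\star_{\ell,h}(B)\bigr]\quad\text{at integer }B$$ (left and right difference quotients). Consider the relaxation $$\min_{\{B_{\ell,h}\}\in\mathbb{R}_{\ge B_{\min}}^{LH}}\;\sum_{\ell,h}\widetilde D^\star_{\ell,h}(B_{\ell,h})\quad\text{s.t.}\quad\sum_{\ell,h}B_{\ell,h}=B_{\mathrm{tot}} .$$ At any stationary point $\{B^\star_{\ell,h}\}$ there exists $\nu^\star\ge0$ such that for all heads with $B^\star_{\ell,h}>B_{\min}$, $$-\nu^\star\in\partial\widetilde D^\star_{\ell,h}(B^\star_{\ell,h}),$$ and $B^\star_{\ell,h}=B_{\min}$ for the remaining heads (complementary slackness). On interior points where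 $\widetilde D^\star_{\ell,h}$ is differentiable, this reduces to the statement that marginal distortions are equalized, i.e. $(\widetilde D^\star_{\ell,h})'(B^\star_{\ell,h})=-\nu^\star$.
   Context: $L$ is the number of layers and $H$ the number of key-value heads per layer; $B_{\min}$ is the minimum per-head bit budget and $B_{\mathrm{tot}}$ the total bit budget. For a head with covariance eigenvalues $\lambda_1\ge\dots\ge\lambda_d\ge0$, $D^\star(B)=\min\{D(r,b):rb\le B\}$ over integer grids of rank $r$ and bit width $b$, with $D(r,b)=\sum_{i>r}\lambda_i+\tfrac1{12}2^{-2b}\sum_{i\le r}\lambda_i$. $\partial$ denotes the convex sub-differential. *)

(* Defs.v *)
From mathcomp Require Export all_boot all_order all_algebra.
From mathcomp Require Export all_classical all_reals all_analysis.
Export Order.TTheory GRing.Theory Num.Theory numFieldNormedType.Exports.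

Set Implicit Arguments.
Unset Strict Implicit.
Unset Printing Implicit Defensive.

Local Open Scope classical_set_scope.
Local Open Scope ring_scope.

Section HeadDistortion.
Variables (R : realType) (d : nat).
Implicit Types (ranks widths : set nat) (lam : 'I_d -> R) (r b B : nat).

(* [lam i] is the eigenvalue of index i + 1 in the usual 1-based numbering, so
   "index > r" reads [r <= i] here. *)
Definition distortion lam r b : R :=
  \sum_(i < d | (r <= i)%N) lam i
  + 12%:R^-1 * 2%:R ^- (2 * b) * \sum_(i < d | (i < r)%N) lam i.

(* The pairs (rank, bit width) of the integer grid ranks x widths that fit in
   the budget B. *)
Definition affordable ranks widths B : set (nat * nat) :=
  [set p | [/\ ranks p.1, widths p.2, (p.1 <= d)%N & (p.1 * p.2 <= B)%N]].

(* The infimum is a minimum as soon as some pair is affordable: see [Dstar_min]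
   below. *)
Definition Dstar ranks widths lam B : R :=
  inf [set distortion lam p.1 p.2 | p in affordable ranks widths B].

Lemma finite_distortions ranks widths lam B :
  finite_set [set distortion lam p.1 p.2 | p in affordable ranks widths B].
Proof.
apply: (@sub_finite_set _ _
  ((fun p : 'I_d.+1 * 'I_B.+1 => distortion lam p.1 p.2) @` setT)); last first.
  exact: finite_image.
move=> _ [[[|r] b] [/= _ _ rd rbB] <-].
- exists (ord0, ord0) => //=; rewrite /distortion; congr (_ + _).
  by rewrite !big_pred0 ?mulr0.
- have bB : (b < B.+1)%N.
    by rewrite ltnS (leq_trans _ rbB)// leq_pmull.
  by exists (Ordinal (rd : (r.+1 < d.+1)%N), Ordinal bB).
Qed.

Lemma Dstar_min ranks widths lam B : affordable ranks widths B !=set0 ->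
  (exists2 p, affordable ranks widths B p &
     Dstar ranks widths lam B = distortion lam p.1 p.2) /\
  (forall p, affordable ranks widths B p ->
     Dstar ranks widths lam B <= distortion lam p.1 p.2).
Proof.
move=> [p0 Ap0]; have := finite_distortions ranks widths lam B.
rewrite /Dstar; set A := [set _ | _ in _].
move=> /finite_seqP[s As].
have A0 : A (distortion lam p0.1 p0.2) by exists p0.
pose m := \big[Order.min/distortion lam p0.1 p0.2]_(x <- s) x.
have mlb : lbound A m.
  by move=> x; rewrite As /= => xs; exact: ge_bigmin_seq.
have Am : A m.
  rewrite /m big_seq; elim/big_ind : _ => //.
  - by move=> x y Ax Ay; rewrite minEle; case: ifP.
  - by move=> x xs; rewrite As.
have -> : inf A = m.
  apply/eqP; rewrite eq_le; apply/andP; split.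
    by apply: ge_inf => //; exists m.
  by apply: lb_le_inf => //; exists m.
split; first by have [p Ap <-] := Am; exists p.
by move=> p Ap; apply: mlb; exists p.
Qed.

End HeadDistortion.

Section Envelope.
Variable R : realType.

(* For x >= 0, [Num.truncn x] is the floor of x, and the value at x is read on
   the segment joining (n, D n) to (n + 1, D (n + 1)), n = floor x.  Only the
   restriction to [budgets Bmin] is meant; below it the value is junk. *)
Definition envelope (D : nat -> R) (x : R) : R :=
  let n := Num.truncn x in D n + (x - n%:R) * (D n.+1 - D n).

Definition budgets (Bmin : nat) : set R := `[Bmin%:R, +oo[.

(* Convex sub-differential at x of f : S -> R, with S a set of reals: the
   inequality is required on S only (f is +oo outside of S). *)
Definition subdifferential (S : set R) (f : R -> R) (x : R) : set R :=
  [set g | forall y, S y -> f x + g * (y - x) <= f y].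

End Envelope.

Arguments budgets : clear implicits.

Section Stationarity.
Variables (R : realType) (V : lmodType R).

Definition is_right_derivative_along (F : V -> R) (x v : V) (l : R) : Prop :=
  t^-1 * (F (x + t *: v) - F x) @[t --> (0 : R)^'+] --> l.

(* First-order stationarity for minimizing a non-smooth F over a convex set C:
   the one-sided derivative of F is nonnegative along every feasible
   direction. *)
Definition stationary_point (C : set V) (F : V -> R) (x : V) : Prop :=
  C x /\ forall y, C y ->
    exists2 l, is_right_derivative_along F x (y - x) l & 0 <= l.

End Stationarity.

Section Relaxation.
Variables (R : realType) (L H : nat).

(* An element of R^(L H) is an L x H matrix: entry (l, h) is the budget of
   head h in layer l. *)
Definition allocations (Bmin : nat) (Btot : R) : set 'M[R]_(L, H) :=
  [set B | (forall l h, budgets R Bmin (B l h)) /\ \sum_l \sum_h B l h = Btot].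

Definition total_distortion (f : 'I_L -> 'I_H -> R -> R) (B : 'M[R]_(L, H)) : R :=
  \sum_l \sum_h f l h (B l h).

End Relaxation.

(* Main.v *)
(* The line through two consecutive points of a discrete-convex sequence stays
   below its piecewise-linear envelope, which is thus a supremum of lines;
   convexity, monotonicity, the Lipschitz bound and the sub-differential all follow.  By
   convexity a stationary allocation is a global minimum.  Moving a small budget
   from a head q above the minimum budget to a head p then cannot help: the left
   slope at q is at most the right slope at p.  Hence some constant separates the
   left slopes of all such heads from their right slopes; this is -nu. *)
Require Import Defs.
From mathcomp Require Import unstable ring lra.

Set Implicit Arguments.
Unset Strict Implicit.
Unset Printing Implicit Defensive.

Local Open Scope classical_set_scope.
Local Open Scope ring_scope.
Local Open Scope convex_scope.

Lemma budgetsE (R : realType) (Bmin : nat) (x : R) :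
  budgets R Bmin x = (Bmin%:R <= x) :> Prop.
Proof. by rewrite /budgets/= in_itv/= andbT. Qed.

(** * Chords and the envelope of a discrete-convex sequence *)

Section IncrementsAndEnvelope.
Variables (R : realType) (D : nat -> R) (Bmin : nat).

Definition increment (n : nat) : R := D n.+1 - D n.

(** The right endpoint is allowed: the floor jumps there, but adjacent segments share the value
    [D n.+1]. At an integer, either neighbouring segment may thus be used. *)
Lemma envelope_segment n (x : R) : n%:R <= x <= n.+1%:R ->
  envelope D x = D n + (x - n%:R) * increment n.
Proof.
move=> /andP[nx]; rewrite le_eqVlt /envelope => /orP[/eqP->|xn].
  by rewrite natrK subrr mul0r addr0 -natr1 /increment; ring.
by rewrite (@truncn_def _ x n) ?nx.
Qed.

Lemma envelope_nat n : envelope D n%:R = D n.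
Proof. by rewrite /envelope natrK subrr mul0r addr0. Qed.

Lemma envelope_ge0 (x : R) : (forall n, (Bmin <= n)%N -> 0 <= D n) ->
  Bmin%:R <= x -> 0 <= envelope D x.
Proof.
move=> D0 Bx; have x0 : 0 <= x by exact: le_trans Bx.
have nB : (Bmin <= Num.truncn x)%N by rewrite truncn_ge_nat.
have /andP[nx xn] := truncn_itv x0.
have := D0 _ nB; have := D0 _ (leqW nB); rewrite /envelope; set n := Num.truncn x.
move: nx xn; rewrite -/n -natr1 => nx xn DS0 Dn0.
have -> : D n + (x - n%:R) * (D n.+1 - D n) =
  (n%:R + 1 - x) * D n + (x - n%:R) * D n.+1 by ring.
by rewrite addr_ge0// mulr_ge0//; lra.
Qed.

Hypothesis D_convex : forall B, (Bmin < B)%N ->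
  0 <= D B.+1 - 2%:R * D B + D B.-1.

Lemma le_increment m n : (Bmin <= m)%N -> (m <= n)%N ->
  increment m <= increment n.
Proof.
move=> Bm /subnKC <-; elim: (n - m)%N => [|k IH]; first by rewrite addn0.
apply: le_trans IH _; rewrite addnS.
have /D_convex : (Bmin < (m + k).+1)%N by rewrite ltnS (leq_trans Bm)// leq_addr.
by rewrite /increment /=; lra.
Qed.

(** Induction on the distance between [n] and [m]: each step to the right adds at least
    [increment n], each step to the left takes away at most [increment n]. *)
Lemma chord_le_nat n m : (Bmin <= n)%N -> (Bmin <= m)%N ->
  D n + (m%:R - n%:R) * increment n <= D m.
Proof.
move=> Bn Bm; have [nm|/ltnW mn] := leqP n m.
  rewrite -(subnKC nm); elim: (m - n)%N => [|k IH].
    by rewrite addn0 subrr mul0r addr0.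
  have := le_increment Bn (leq_addr k n); rewrite addnS -natr1 {2}/increment.
  by move: IH; lra.
rewrite -(subnKC mn); move: (n - m)%N => k.
elim: k m Bm {Bn mn} => [|k IH] m Bm.
  by rewrite addn0 subrr mul0r addr0.
have := IH _ (leqW Bm); have := le_increment Bm (leq_addr k.+1 m).
by rewrite addSnnS -natr1 {1}/increment; lra.
Qed.

Lemma chord_le_envelope n (y : R) : (Bmin <= n)%N -> Bmin%:R <= y ->
  D n + (y - n%:R) * increment n <= envelope D y.
Proof.
move=> Bn By; have y0 : 0 <= y by exact: le_trans By.
have Bm : (Bmin <= Num.truncn y)%N by rewrite truncn_ge_nat.
have := chord_le_nat Bn Bm; have := chord_le_nat Bn (leqW Bm).
have /andP := truncn_itv y0.
rewrite /envelope; set m := Num.truncn y; rewrite -natr1 => -[my ym] leS le.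
(* Both sides are affine in [y] on this segment: they become the same convex combination of their
   values at [m] and [m + 1], where the bound is known. *)
have -> : D m + (y - m%:R) * (D m.+1 - D m) =
  (m%:R + 1 - y) * D m + (y - m%:R) * D m.+1 by ring.
have -> : D n + (y - n%:R) * increment n =
  (m%:R + 1 - y) * (D n + (m%:R - n%:R) * increment n)
   + (y - m%:R) * (D n + (m%:R + 1 - n%:R) * increment n) by ring.
by rewrite lerD// ler_wpM2l//; lra.
Qed.

(** The chord of the segment containing the convex combination [z] meets the envelope at [z] and
    minorizes it at the two given points; average these two bounds. *)
Lemma convex_envelope : convex_function (budgets R Bmin) (envelope D).
Proof.
move=> t x y /[!inE] /[!budgetsE] => Bx By.
rewrite [_ <| t |> _]convRE [leRHS]convRE.
have t0 : 0 <= t%:num by [].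
have t1 : 0 <= t%:num.~ by rewrite onem_ge0.
have Bz : Bmin%:R <= t%:num * x + t%:num.~ * y.
  have : 0 <= t%:num * (x - Bmin%:R) by rewrite mulr_ge0// subr_ge0.
  have : 0 <= t%:num.~ * (y - Bmin%:R) by rewrite mulr_ge0// subr_ge0.
  by rewrite /onem; lra.
set z := _ + _ in Bz *.
have Bn : (Bmin <= Num.truncn z)%N by rewrite truncn_ge_nat// (le_trans _ Bz).
have := ler_wpM2l t0 (chord_le_envelope Bn Bx).
have := ler_wpM2l t1 (chord_le_envelope Bn By).
move=> ly lx; apply: le_trans (lerD lx ly); rewrite /envelope -/(increment _).
by rewrite le_eqVlt; apply/orP; left; apply/eqP; rewrite /z /onem; ring.
Qed.

(** [m] indexes the segment just left of [x] and [n] the one just right; they differ only when [x]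
    is an integer. Chord [n] handles the points [y >= x], chord [m] the others. *)
Lemma subdifferential_envelope m n (x g : R) : (Bmin <= m)%N ->
  m%:R < x <= m.+1%:R -> n%:R <= x < n.+1%:R ->
  increment m <= g <= increment n ->
  subdifferential (budgets R Bmin) (envelope D) x g.
Proof.
move=> Bm /andP[mx xm] /andP[nx xn] /andP[mg gn] y.
rewrite budgetsE => By.
have mn : (m <= n)%N.
  by rewrite -ltnS -(ltr_nat R) (lt_trans mx).
have [xy|yx] := leP x y.
  have := chord_le_envelope (leq_trans Bm mn) By.
  rewrite (@envelope_segment n x); last by rewrite nx ltW.
  have : 0 <= (y - x) * (increment n - g) by rewrite mulr_ge0// subr_ge0.
  by lra.
have := chord_le_envelope Bm By.
rewrite (@envelope_segment m x); last by rewrite xm ltW.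
have : 0 <= (x - y) * (g - increment m) by rewrite mulr_ge0// subr_ge0// ltW.
by lra.
Qed.

Lemma subdifferential_envelope_nat (B : nat) : (Bmin < B)%N ->
  subdifferential (budgets R Bmin) (envelope D) B%:R =
  `[D B - D B.-1, D B.+1 - D B]%classic.
Proof.
move=> BB; have B0 : (0 < B)%N by exact: leq_ltn_trans BB.
apply/seteqP; split => g /=; rewrite in_itv/=.
  (* Test the sub-gradient inequality at both integer neighbours; [Bmin < B] keeps [B.-1] in the
     domain. *)
  move=> Bg.
  have /Bg : budgets R Bmin B.-1%:R.
    by rewrite budgetsE ler_nat -ltnS prednK.
  have /Bg : budgets R Bmin B.+1%:R.
    by rewrite budgetsE ler_nat ltnW// ltnW.
  rewrite !envelope_nat -natr1 (_ : B%:R = B.-1%:R + 1) => [gS gP|].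
    by apply/andP; split; lra.
  by rewrite natr1 prednK.
move=> Bg; apply: (@subdifferential_envelope B.-1 B) => //.
- by rewrite -ltnS prednK.
- by rewrite prednK// lexx andbT ltr_nat prednK.
- by rewrite lexx ltr_nat ltnSn.
- by rewrite /increment prednK.
Qed.

Hypothesis D_noninc : forall B, (Bmin <= B)%N -> D B.+1 <= D B.

Lemma increment_le0 n : (Bmin <= n)%N -> increment n <= 0.
Proof. by move=> /D_noninc; rewrite /increment subr_le0. Qed.

Lemma envelope_noninc :
  {in budgets R Bmin &, {homo envelope D : x y /~ x <= y}}.
Proof.
move=> y x /[!inE] /[!budgetsE] => By Bx xy.
have Bn : (Bmin <= Num.truncn y)%N by rewrite truncn_ge_nat// (le_trans _ By).
apply: le_trans (chord_le_envelope Bn Bx); rewrite {1}/envelope -/(increment _).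
by rewrite lerD2l ler_wnM2r ?increment_le0// lerD2r.
Qed.

(** The first slope is the steepest, since increments grow with the index but stay nonpositive. *)
Lemma envelope_lipschitz (x y : R) : Bmin%:R <= x -> Bmin%:R <= y ->
  `|envelope D x - envelope D y| <= - increment Bmin * `|x - y|.
Proof.
wlog xy : x y / x <= y.
  have [xy|/ltW yx] := leP x y; first exact.
  by move=> H Bx By; rewrite distrC [`|x - _|]distrC; exact: H.
move=> Bx By; have Bn : (Bmin <= Num.truncn x)%N.
  by rewrite truncn_ge_nat// (le_trans _ Bx).
have yx : envelope D y <= envelope D x.
  by apply: envelope_noninc => //; rewrite inE budgetsE.
rewrite ger0_norm ?subr_ge0// distrC ger0_norm ?subr_ge0//.
have /ler_wpM2l -/(_ (y - x)) := le_increment (leqnn _) Bn.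
rewrite subr_ge0 => /(_ xy).
have := chord_le_envelope Bn By.
have : envelope D x = D (Num.truncn x) +
  (x - (Num.truncn x)%:R) * increment (Num.truncn x) by [].
lra.
Qed.

Lemma envelope_continuous : {within budgets R Bmin, continuous (envelope D)}.
Proof.
apply/subspace_continuousP => x; rewrite budgetsE => Bx.
have K0 : 0 <= - increment Bmin by rewrite oppr_ge0 increment_le0.
apply/cvgrPdist_le => e e0; rewrite near_withinE; near=> y.
rewrite budgetsE => By; apply: le_trans (envelope_lipschitz Bx By) _.
(* The added 1 keeps the denominator positive when [increment Bmin] is zero. *)
have : `|x - y| <= e / (- increment Bmin + 1).
  by near: y; apply: cvgr_dist_le; [exact: cvg_id|rewrite divr_gt0// ltr_wpDl].
rewrite ler_pdivlMr ?ltr_wpDl//; have := normr_ge0 (x - y); nra.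
Unshelve. all: by end_near. Qed.

End IncrementsAndEnvelope.

(** * Sub-gradients, stationarity and convexity *)

(** Difference quotients are at most [g] from the left and at least [g] from the right, and both
    tend to the derivative. *)
Lemma derive1_subdifferential (R : realType) (S : set R) (f : R -> R) (x g : R) :
  nbhs x S -> derivable f x 1 -> subdifferential S f x g -> f^`()%classic x = g.
Proof.
move=> Sx dfx gx; pose q h := h^-1 *: (f (h + x) - f x).
have qD : q h @[h --> 0^'] --> f^`()%classic x.
  rewrite derive1E.
  suff -> : q = fun h => h^-1 *: ((f \o shift x) (h *: 1) - f x).
    exact: dfx.
  by apply/funext => h; rewrite /q /= [h *: 1]mulr1.
have S0 : \forall h \near (0 : R), S (h + x).
  by move/nbhs0P : Sx; apply: filterS => h; rewrite addrC.
apply/eqP; rewrite eq_le; apply/andP; split.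
  apply: (cvgr_to_le (cvg_dnbhs_at_left qD)); near=> h.
  have h0 : h < 0 by near: h; exact: nbhs_left_lt.
  rewrite /q /GRing.scale/= mulrC ler_ndivrMr//.
  have /gx : S (h + x) by near: h; exact: cvg_within.
  lra.
apply: (cvgr_to_ge (cvg_dnbhs_at_right qD)); near=> h.
have h0 : 0 < h by near: h; exact: nbhs_right_gt.
rewrite /q /GRing.scale/= mulrC ler_pdivlMr//.
have /gx : S (h + x) by near: h; exact: cvg_within.
lra.
Unshelve. all: by end_near. Qed.

(** By convexity the difference quotient along [y - x] is at most [F y - F x] for [0 < t <= 1]; so
    is its limit, which stationarity makes nonnegative. *)
Lemma stationary_point_min (R : realType) (V : lmodType R) (C : set V)
    (F : V -> R) (x y : V) :
  convex_function C F -> stationary_point C F x -> C y -> F x <= F y.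
Proof.
move=> convF [Cx stat] Cy; have [l Fl l0] := stat _ Cy.
rewrite -subr_ge0 (le_trans l0)//; apply: (cvgr_to_le Fl); near=> t.
have t0 : 0 < t by near: t; exact: nbhs_right_gt.
have t1 : t <= 1 by near: t; exact: nbhs_right_ltW.
have := convF (Itv01 (ltW t0) t1) y x; rewrite !inE => /(_ Cy Cx).
rewrite [leRHS]convRE/= (_ : conv _ _ _ = (x + t *: (y - x) : convex_lmodType V));
    last first.
  by rewrite /conv/= /onem scalerBl scale1r scalerBr; exact: addrCA.
move=> Ft; rewrite mulrC ler_pdivrMr//; move: Ft; rewrite /onem; lra.
Unshelve. all: by end_near. Qed.

Lemma convex_total_distortion (R : realType) (L H : nat) (S : set R)
    (f : 'I_L -> 'I_H -> R -> R) :
  (forall l h, convex_function S (f l h)) ->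
  convex_function [set B : 'M[R]_(L, H) | forall l h, S (B l h)]
    (total_distortion f).
Proof.
move=> convf t A B; rewrite !inE/= => SA SB.
rewrite [leRHS]convRE /total_distortion !mulr_sumr -big_split/=.
apply: ler_sum => l _; rewrite !mulr_sumr -big_split/=; apply: ler_sum => h _.
have := convf l h t (A l h) (B l h); rewrite !inE => /(_ (SA l h) (SB l h)).
by rewrite [leRHS]convRE [_ <| t |> _]convRE /conv/= !mxE.
Qed.

(** * Separation of slopes and transfers of budget between two heads *)

Lemma sum_update2 (V : zmodType) (I : finType) (p q : I) (x y : I -> V) :
  p != q -> (forall i, i != p -> i != q -> y i = x i) ->
  \sum_i y i = \sum_i x i + (y p - x p) + (y q - x q).
Proof.
move=> pq yx; rewrite -addrA; apply: (canRL (subrKC _)).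
rewrite -sumrB (bigD1 p)//=.
rewrite (bigD1 q) 1?eq_sym//= addrA big1 ?addr0// => i /andP[ip iq].
by rewrite yx// subrr.
Qed.

(** The largest [a i] serves as [c], or [c0] itself when no index satisfies [P]. *)
Lemma separate_families (R : realDomainType) (I : finType) (P : pred I)
    (a b : I -> R) (c0 : R) :
  (forall i, P i -> a i <= c0) -> (forall i j, P i -> P j -> a i <= b j) ->
  exists2 c, c <= c0 & forall i, P i -> a i <= c <= b i.
Proof.
move=> ac0 ab; have [i0 Pi0|P0] := pickP P; last first.
  by exists c0 => // i; rewrite P0.
case: (arg_maxP a Pi0) => i Pi imax; exists (a i); first exact: ac0.
by move=> j Pj; rewrite ab// andbT; exact: imax.
Qed.
Lemma min_total_distortion_transfer (R : realType) (L H Bmin : nat) (Btot : R)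
    (f : 'I_L -> 'I_H -> R -> R) (B : 'M[R]_(L, H)) (p q : 'I_L * 'I_H) (e : R) :
  allocations Bmin Btot B ->
  (forall B', allocations Bmin Btot B' ->
     total_distortion f B <= total_distortion f B') ->
  p != q -> 0 <= e -> Bmin%:R + e <= B q.1 q.2 ->
  f p.1 p.2 (B p.1 p.2) + f q.1 q.2 (B q.1 q.2) <=
  f p.1 p.2 (B p.1 p.2 + e) + f q.1 q.2 (B q.1 q.2 - e).
Proof.
move=> [BB Bsum] opt pq e0 Bq.
(* Moving [e] from [q] to [p] preserves the total, and [Bmin%:R + e <= B q.1 q.2] keeps [q]
   feasible. *)
pose B' : 'M[R]_(L, H) := \matrix_(l, h)
  if (l, h) == p then B l h + e else if (l, h) == q then B l h - e else B l h.
have B'p : B' p.1 p.2 = B p.1 p.2 + e by rewrite mxE -surjective_pairing eqxx.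
have B'q : B' q.1 q.2 = B q.1 q.2 - e.
  by rewrite mxE -surjective_pairing eq_sym (negbTE pq) eqxx.
have B'E i : i != p -> i != q -> B' i.1 i.2 = B i.1 i.2.
  by move=> ip iq; rewrite mxE -surjective_pairing (negbTE ip) (negbTE iq).
have allocB' : allocations Bmin Btot B'.
  split=> [l h|].
    have := BB l h; rewrite !budgetsE mxE => BBlh.
    case: eqP => _; first by rewrite ler_wpDr.
    case: eqP => // lhq; move: Bq; rewrite -lhq/=; lra.
  rewrite pair_bigA/= -Bsum pair_bigA/=.
  rewrite (@sum_update2 _ _ _ _ (fun i => B i.1 i.2) _ pq)// B'p B'q; lra.
have := opt _ allocB'; rewrite /total_distortion !pair_bigA/=.
rewrite [leRHS](@sum_update2 _ _ _ _ (fun i => f i.1 i.2 (B i.1 i.2)) _ pq).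
  by rewrite B'p B'q; lra.
by move=> i ip iq; rewrite B'E.
Qed.

(** The segment is open on the left, so at an integer [x] its index is one below the floor; the
    strict [n%:R < x] keeps that index at least [n]. *)
Lemma left_segment (R : realType) (n : nat) (x : R) : n%:R < x ->
  exists2 m, (n <= m)%N & m%:R < x <= m.+1%:R.
Proof.
move=> nx; have x0 : 0 <= x by rewrite ltW// (le_lt_trans _ nx).
have /andP[] := truncn_itv x0; rewrite le_eqVlt => /orP[/eqP xE _|kx xk].
  have nk : (n < Num.truncn x)%N by rewrite -(ltr_nat R) xE.
  have k0 : (0 < Num.truncn x)%N by exact: leq_ltn_trans nk.
  exists (Num.truncn x).-1; first by rewrite -ltnS prednK.
  by rewrite prednK// -{2 3}xE lexx andbT ltr_nat prednK.
exists (Num.truncn x); last by rewrite kx ltW.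
by rewrite truncn_ge_nat// ltW.
Qed.

Lemma Dstar_ge0 (R : realType) (d : nat) (ranks widths : set nat)
    (lam : 'I_d -> R) (B : nat) : (forall i, 0 <= lam i) ->
  0 <= Dstar ranks widths lam B.
Proof.
move=> lam0; rewrite /Dstar; set A := (X in inf X).
(* With no affordable pair, the infimum takes its default value 0. *)
have [->|/set0P A0] := eqVneq A set0; first by rewrite inf0.
apply: lb_le_inf => // _ [p _ <-].
by rewrite addr_ge0 ?mulr_ge0 ?invr_ge0 ?exprn_ge0// sumr_ge0.
Qed.

Theorem propositionC2 (R : realType) (L H d : nat) (ranks widths : set nat)
    (Bmin : nat) (Btot : R) (lam : 'I_L -> 'I_H -> 'I_d -> R)
    (D : 'I_L -> 'I_H -> nat -> R)
    (Dt : 'I_L -> 'I_H -> R -> R)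
    (lam_ge0 : forall l h i, 0 <= lam l h i)
    (lam_noninc : forall l h (i j : 'I_d), (i <= j)%N -> lam l h j <= lam l h i)
    (affordable_Bmin : affordable d ranks widths Bmin !=set0)
    (D_def : D = fun l h => Dstar ranks widths (lam l h))
    (Dt_def : Dt = fun l h => envelope (D l h))
    (D_noninc : forall l h (B : nat), (Bmin <= B)%N -> D l h B.+1 <= D l h B)
    (D_convex : forall l h (B : nat), (Bmin < B)%N ->
       0 <= D l h B.+1 - 2%:R * D l h B + D l h B.-1) :
  (forall l h,
     [/\ (forall x, budgets R Bmin x -> 0 <= Dt l h x),
         convex_function (budgets R Bmin) (Dt l h),
         {in budgets R Bmin &, {homo Dt l h : x y /~ x <= y}},
         {within budgets R Bmin, continuous (Dt l h)} &
         forall B : nat, (Bmin < B)%N ->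
           subdifferential (budgets R Bmin) (Dt l h) B%:R =
           `[D l h B - D l h B.-1, D l h B.+1 - D l h B]%classic])
  /\
  (forall Bs : 'M[R]_(L, H),
     stationary_point (allocations Bmin Btot) (total_distortion Dt) Bs ->
     exists nu : R, 0 <= nu /\
       forall l h,
         [/\ Bmin%:R < Bs l h ->
               subdifferential (budgets R Bmin) (Dt l h) (Bs l h) (- nu),
             ~ Bmin%:R < Bs l h -> Bs l h = Bmin%:R &
             Bmin%:R < Bs l h -> derivable (Dt l h) (Bs l h) 1 ->
               (Dt l h)^`()%classic (Bs l h) = - nu]).
Proof.
split=> [l h|Bs statB].
  split.
  - move=> x; rewrite budgetsE Dt_def => Bx; apply: envelope_ge0 Bx => n _.
    by rewrite D_def; exact: Dstar_ge0.
  - by rewrite Dt_def; exact: (convex_envelope (D_convex l h)).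
  - by rewrite Dt_def; exact: envelope_noninc (D_convex l h) (D_noninc l h).
  - by rewrite Dt_def; exact: envelope_continuous (D_convex l h) (D_noninc l h).
  - move=> B BB; rewrite Dt_def.
    exact: subdifferential_envelope_nat (D_convex l h) _ BB.
have allocB := statB.1.
have minB B' : allocations Bmin Btot B' ->
    total_distortion Dt Bs <= total_distortion Dt B'.
  move=> allocB'; apply: stationary_point_min statB allocB'.
  have convD : convex_function
      [set B : 'M[R]_(L, H) | forall l h, budgets R Bmin (B l h)]
      (total_distortion Dt).
    apply: convex_total_distortion => l h.
    by rewrite Dt_def; exact: (convex_envelope (D_convex l h)).
  by move=> t A B /set_mem[SA _] /set_mem[SB _]; apply: convD; rewrite inE.
pose b (p : 'I_L * 'I_H) := Bs p.1 p.2.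
(* [m p] indexes the segment left of the budget of [p], and the floor [n p] the one to its right;
   their increments are the left and right slopes. *)
have /choice[m mP] p : exists k, Bmin%:R < b p ->
    (Bmin <= k)%N /\ k%:R < b p <= k.+1%:R.
  have [/left_segment[k Bk kb]|bB] := ltP Bmin%:R (b p); first by exists k.
  by exists 0%N.
pose n p := Num.truncn (b p).
have nP p : (n p)%:R <= b p < (n p).+1%:R.
  rewrite truncn_itv//; have := allocB.1 p.1 p.2.
  by rewrite budgetsE; exact: le_trans.
have slopes p q : Bmin%:R < b p -> Bmin%:R < b q ->
    increment (D q.1 q.2) (m q) <= increment (D p.1 p.2) (n p).
  move=> Bp Bq; have [Bmp /andP[mp _]] := mP _ Bp.
  have [Bmq /andP[mq qm]] := mP _ Bq.
  have /andP[np pn] := nP p.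
  (* A transfer needs two distinct heads; for a single head the inequality is the monotonicity of
     increments. *)
  have [pq|pq] := eqVneq q p.
    rewrite pq; apply: (le_increment (D_convex _ _)) => //.
    by rewrite -ltnS -(ltr_nat R) (lt_trans mp).
  (* With this e, neither head leaves the segment next to its budget. *)
  pose e := Num.min ((n p).+1%:R - b p) (b q - (m q)%:R).
  have e0 : 0 < e by rewrite lt_min !subr_gt0 pn mq.
  have ep : b p + e <= (n p).+1%:R by rewrite addrC -lerBrDr ge_min lexx.
  have eq : (m q)%:R <= b q - e by rewrite lerBrDl -lerBrDr ge_min lexx orbT.
  have Bqe : Bmin%:R + e <= b q.
    by rewrite -lerBrDr (le_trans _ eq)// ler_nat.
  have {}pq : p != q by rewrite eq_sym.
  have := min_total_distortion_transfer allocB minB pq (ltW e0) Bqe.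
  rewrite Dt_def -!/(b _).
  rewrite (@envelope_segment _ _ (n p) (b p)); last by rewrite np ltW.
  rewrite (@envelope_segment _ _ (n p) (b p + e)); last first.
    by rewrite ep ler_wpDr// ltW.
  rewrite (@envelope_segment _ _ (m q) (b q)); last by rewrite qm ltW.
  rewrite (@envelope_segment _ _ (m q) (b q - e)); last first.
    by rewrite eq (le_trans _ qm)// gerBl ltW.
  (* All four values lie on known segments, so the transfer inequality compares the two slopes
     multiplied by [e]. *)
  move=> le; rewrite -(ler_pM2l e0); move: le; lra.
(* Left slopes are nonpositive, so 0 can serve as the upper bound on [c]; this makes the multiplier
   [- c] nonnegative. *)
have [c c0 cP] : exists2 c, c <= 0 & forall p, Bmin%:R < b p ->
    increment (D p.1 p.2) (m p) <= c <= increment (D p.1 p.2) (n p).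
  apply: separate_families => [p Bp|p q Bp Bq]; last exact: slopes.
  exact: increment_le0 (D_noninc _ _) _ (mP _ Bp).1.
have sub l h : Bmin%:R < Bs l h ->
    subdifferential (budgets R Bmin) (Dt l h) (Bs l h) c.
  move=> Blh; have [Bm mb] := mP (l, h) Blh; rewrite Dt_def.
  exact: (subdifferential_envelope (D_convex l h) Bm mb (nP (l, h))
    (cP (l, h) Blh)).
exists (- c); split=> [|l h]; first by rewrite oppr_ge0.
rewrite opprK; split; first exact: sub.
  move=> /negP; rewrite -leNgt => BB; apply/eqP; rewrite eq_le BB/=.
  by have := allocB.1 l h; rewrite budgetsE.
move=> Blh dB; apply: derive1_subdifferential dB (sub _ _ Blh).
(* Strictly above [Bmin], a whole neighbourhood lies in the domain, so both one-sided comparisons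
   apply. *)
apply: filterS (lt_nbhsr Blh) => y /ltW.
by rewrite budgetsE.
Qed.
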